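(* For all integers $n\ge 1$ and $m\ge 3$, $$\hat{r}_c(2K_2,nP_m)=nm+1.$$
   Context: All graphs are finite and simple. The size $e(F)$ of a graph $F$ is its number of edges. For graphs $F,G,H$, write $F\to(G,H)$ if for every coloring of the edges of $F$ with the colors red and blue, $F$ contains either a subgraph isomorphic to $G$ all of whose edges are red, or a subgraph isomorphic to $H$ all of whose edges are blue (subgraphs are not necessarily induced). The connected size Ramsey number $\hat{r}_c(G,H)$ is the smallest possible size of a connected graph $F$ with $F\to(G,H)$. $P_m$ denotes the path on $m$ vertices (with $m-1$ edges), $nP_m$ is the disjoint union of $n$ copies of $P_m$, and $2K_2$ is the disjoint union of two edges (a matching of size 2). *)

(* Defs.v *)
From mathcomp Require Import all_boot.

Set Implicit Arguments.
Unset Strict Implicit.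
Unset Printing Implicit Defensive.

Record sgraph := SGraph {
  vertex :> finType;
  adj : rel vertex;
  adj_sym : symmetric adj;
  adj_irrefl : irreflexive adj }.

Definition edges (F : sgraph) : {set {set F}} :=
  [set [set p.1; p.2] | p : F * F & adj p.1 p.2].

Definition gsize (F : sgraph) : nat := #|edges F|.

Definition connected (F : sgraph) : Prop :=
  0 < #|F| /\ forall x y : F, connect (@adj F) x y.

(* F has a (not necessarily induced) subgraph isomorphic to G. *)
Definition contains (F G : sgraph) : Prop :=
  exists f : G -> F,
    injective f /\ forall x y : G, adj x y -> adj (f x) (f y).

Inductive colour := Red | Blue.

Definition is_colour (a b : colour) : bool :=
  match a, b with Red, Red | Blue, Blue => true | _, _ => false end.

Section ColourClass.
Variables (F : sgraph) (c : {set F} -> colour) (a : colour).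

Definition colour_adj : rel F :=
  fun x y => adj x y && is_colour (c [set x; y]) a.

Lemma colour_adj_sym : symmetric colour_adj.
Proof. by move=> x y; rewrite /colour_adj adj_sym setUC. Qed.

Lemma colour_adj_irrefl : irreflexive colour_adj.
Proof. by move=> x; rewrite /colour_adj adj_irrefl. Qed.

Definition colour_class : sgraph := SGraph colour_adj_sym colour_adj_irrefl.

End ColourClass.

(* F -> (G, H). A colouring is a function on all sets of vertices, but only
   its values on the edges of F are ever used. *)
Definition arrows (F G H : sgraph) : Prop :=
  forall c : {set F} -> colour,
    contains (colour_class c Red) G \/ contains (colour_class c Blue) H.

(* r is the connected size Ramsey number of (G, H). *)
Definition is_conn_size_ramsey (G H : sgraph) (r : nat) : Prop :=
  (exists F : sgraph, [/\ connected F, arrows F G H & gsize F = r]) /\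
  (forall F : sgraph, connected F -> arrows F G H -> r <= gsize F).

Lemma conn_size_ramsey_unique (G H : sgraph) (r s : nat) :
  is_conn_size_ramsey G H r -> is_conn_size_ramsey G H s -> r = s.
Proof.
move=> [[F [cF aF <-]] minF] [[F' [cF' aF' <-]] minF'].
by apply/eqP; rewrite eqn_leq minF // minF'.
Qed.

Section Families.
Variable n : nat.

Definition path_adj : rel 'I_n := fun i j => (i.+1 == j) || (j.+1 == i).

Lemma path_adj_sym : symmetric path_adj.
Proof. by move=> i j; rewrite /path_adj orbC. Qed.

Lemma path_adj_irrefl : irreflexive path_adj.
Proof. by move=> i; rewrite /path_adj orbb gtn_eqF. Qed.

Definition path_graph : sgraph := SGraph path_adj_sym path_adj_irrefl.

Definition complete_adj : rel 'I_n := fun i j => i != j.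

Lemma complete_adj_sym : symmetric complete_adj.
Proof. by move=> i j; rewrite /complete_adj eq_sym. Qed.

Lemma complete_adj_irrefl : irreflexive complete_adj.
Proof. by move=> i; rewrite /complete_adj eqxx. Qed.

Definition complete_graph : sgraph :=
  SGraph complete_adj_sym complete_adj_irrefl.

Variable G : sgraph.

Definition copies_adj : rel ('I_n * G)%type :=
  fun u v => (u.1 == v.1) && adj u.2 v.2.

Lemma copies_adj_sym : symmetric copies_adj.
Proof. by move=> u v; rewrite /copies_adj eq_sym adj_sym. Qed.

Lemma copies_adj_irrefl : irreflexive copies_adj.
Proof. by move=> u; rewrite /copies_adj adj_irrefl andbF. Qed.

(* The disjoint union of n copies of G. *)
Definition copies : sgraph := SGraph copies_adj_sym copies_adj_irrefl.

End Families.

(* Main.v *)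
(** Upper bound: in the cycle on [n * m + 1] vertices, a red graph without
    [2 K_2] is contained in the star of some vertex [v], and deleting [v] leaves
    a blue path on [n * m] vertices, which splits into [n] paths [P_m].

    Lower bound: colouring the star of a vertex [u] red forces [n * m] vertices
    that are not isolated in [F - u].  Build [F] up one vertex at a time along
    its edges, and let [y] be the last vertex.  If [y] has two neighbours, then
    [F] has at least [#|F| >= n * m + 1] edges.  Otherwise [y] is isolated in
    [F - u] for its unique neighbour [u], so [#|F| >= n * m + 2], and a
    connected graph has at least [#|F| - 1] edges. *)

Require Import Defs.
From mathcomp Require Import all_boot.
From mathcomp Require Import zify.

Set Implicit Arguments.
Unset Strict Implicit.
Unset Printing Implicit Defensive.

(** * Red stars against matchings of size two *)

Lemma mem_edges (F : sgraph) (x y : F) : adj x y -> [set x; y] \in edges F.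
Proof. by move=> xy; apply/imsetP; exists (x, y); rewrite ?inE. Qed.

Definition star_colouring (F : sgraph) (u : F) (e : {set F}) : colour :=
  if u \in e then Red else Blue.

(** Both edges of such a matching would contain [u], although they are disjoint. *)
Lemma red_star_no_matching (F : sgraph) (u : F) :
  ~ contains (colour_class (star_colouring u) Red)
      (copies 2 (complete_graph 2)).
Proof.
move=> [f [f_inj f_adj]].
have centre (a : 'I_2) : exists b : 'I_2, f (a, b) = u.
  have /f_adj : @adj (copies 2 (complete_graph 2)) (a, ord0) (a, ord_max).
    by rewrite /= /copies_adj eqxx.
  rewrite /= /colour_adj /star_colouring => /andP[_].
  case: ifP => // /set2P[] -> _; first by exists ord0.
  by exists ord_max.
have [[b fb] [b' fb']] := (centre ord0, centre ord_max).
by have [] := f_inj (ord0, b) (ord_max, b') (etrans fb (esym fb')).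
Qed.

Lemma contains_matching (F : sgraph) (x y z t : F) :
    adj x y -> adj z t -> uniq [:: x; y; z; t] ->
  contains F (copies 2 (complete_graph 2)).
Proof.
move=> xy zt xyzt.
(* The index is below 4, so the default [x] is never reached. *)
exists (fun p : 'I_2 * 'I_2 => nth x [:: x; y; z; t] (p.1 * 2 + p.2)); split.
  move=> [a b] [a' b'] /eqP /=.
  have [lt_a lt_b] := (ltn_ord a, ltn_ord b).
  have [lt_a' lt_b'] := (ltn_ord a', ltn_ord b').
  rewrite nth_uniq //=; try lia.
  by move=> /eqP e; congr (_, _); apply: val_inj => /=; lia.
have [yx tz] : adj y x /\ adj t z by rewrite ![_ _ x]adj_sym ![_ _ z]adj_sym.
move=> [a b] [a' b'] /andP[/= /eqP <-].
by case: a b b' => [[|[|a]] lt_a] [[|[|b]] lt_b] [[|[|b']] lt_b'].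
Qed.

Lemma path_graph_neighbour m (i : 'I_m) :
  1 < m -> exists j : 'I_m, @adj (path_graph m) i j.
Proof.
move=> m_gt1; have [lt_im | le_mi] := ltnP i.+1 m.
  by exists (Ordinal lt_im); rewrite /= /path_adj eqxx.
have lt_i'm : i.-1 < m by have := ltn_ord i; lia.
by exists (Ordinal lt_i'm); rewrite /= /path_adj /=; lia.
Qed.

(** Under [star_colouring u] there must be a blue copy of [nP_m]. Since [m > 1], each of its [n * m]
    vertices lies on a blue edge, which avoids [u], and hence belongs to [A]. *)
Lemma arrows_non_isolated (F : sgraph) n m (u : F) (A : {set F}) :
    1 < m -> arrows F (copies 2 (complete_graph 2)) (copies n (path_graph m)) ->
    (forall x z, adj x z -> x != u -> z != u -> x \in A) ->
  n * m <= #|A|.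
Proof.
move=> m_gt1 /(_ (star_colouring u))[/red_star_no_matching // | [f [f_inj f_adj]]].
move=> in_A; have <- : #|[set f x | x in [set: 'I_n * 'I_m]]| = n * m.
  by rewrite card_imset // cardsT card_prod !card_ord.
apply/subset_leq_card/subsetP => _ /imsetP[[a i] _ ->].
have [j ij] := path_graph_neighbour i m_gt1.
have /f_adj : @adj (copies n (path_graph m)) (a, i) (a, j).
  by rewrite /= /copies_adj eqxx.
rewrite /= /colour_adj /star_colouring => /andP[fij].
by case: ifP => // /negbT; rewrite !inE negb_or ![u == _]eq_sym => /andP[]; eauto.
Qed.

(** * Counting edges of a connected graph *)

Definition inner_edges (F : sgraph) (S : {set F}) : {set {set F}} :=
  [set e in edges F | e \subset S].

(** Without such an edge [S] would be a union of connected components. *)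
Lemma connected_boundary (F : sgraph) (S : {set F}) :
    connected F -> S != set0 -> S != setT ->
  exists x y, [/\ x \in S, y \notin S & adj x y].
Proof.
move=> [_ F_conn] /set0Pn[s sS]; rewrite -subTset => /subsetPn[t _ tS].
case: (pickP [pred p : F * F | [&& p.1 \in S, p.2 \notin S & adj p.1 p.2]]).
  by move=> [x y] /and3P[]; exists x, y.
move=> no_edge; suff S_closed : fingraph.closed (@adj F) (mem S).
  by move: tS; rewrite -(closed_connect S_closed (F_conn s t)) sS.
apply: intro_closed => [|x y xy xS].
  exact: (sym_connect_sym (@adj_sym F)).
by have := no_edge (x, y); rewrite /= xS xy andbT => /negbFE.
Qed.

(** The edges in [E] contain [y], so none of them is already counted inside [S]. *)
Lemma inner_edges_setU1 (F : sgraph) (S : {set F}) (y : F) (E : {set {set F}}) :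
    y \notin S -> {in E, forall e, [/\ e \in edges F, y \in e & e \subset y |: S]} ->
  #|inner_edges S| + #|E| <= #|inner_edges (y |: S)|.
Proof.
move=> yS EP; have <- : #|inner_edges S :|: E| = #|inner_edges S| + #|E|.
  have := cardsUI (inner_edges S) E.
  suff -> : inner_edges S :&: E = set0 by rewrite cards0 addn0 => ->.
  apply/setP=> e; rewrite !inE; apply/negP => /andP[/andP[_ /subsetP eS] /EP[_ ye _]].
  by rewrite eS in yS.
apply/subset_leq_card/subsetP => e; rewrite !inE.
case/orP => [/andP[-> eS] | /EP[-> //]].
exact: subset_trans eS (subsetU1 _ _).
Qed.

(** A boundary edge of the current set brings in one new vertex and at least one new inner edge. *)
Lemma connected_growth (F : sgraph) k :
    connected F -> k < #|F| ->
  exists S : {set F}, #|S| = k.+1 /\ k <= #|inner_edges S|.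
Proof.
move=> F_conn; elim: k => [|k IHk] lt_kF.
  by have /card_gt0P[x _] := lt_kF; exists [set x]; rewrite cards1.
have [S [card_S le_kS]] := IHk (ltnW lt_kF).
have [||x [y [xS yS xy]]] := connected_boundary (S := S) F_conn.
- by rewrite -card_gt0 card_S.
- by apply: contraTneq lt_kF => ST; rewrite -cardsT -ST card_S ltnn.
exists (y |: S); rewrite cardsU1 yS card_S; split=> //.
have /(inner_edges_setU1 yS) : {in [set [set x; y]], forall e,
    [/\ e \in edges F, y \in e & e \subset y |: S]}.
  move=> _ /set1P->; rewrite mem_edges // set22; split=> //.
  by apply/subsetP=> z /set2P[]->; rewrite !inE ?eqxx ?xS ?orbT.
by rewrite cards1 addn1; apply: leq_trans.
Qed.

Lemma ramsey_lower_bound (F : sgraph) n m :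
    0 < n -> 1 < m -> connected F ->
    arrows F (copies 2 (complete_graph 2)) (copies n (path_graph m)) ->
  n * m < gsize F.
Proof.
move=> n_gt0 m_gt1 F_conn F_arr.
have [r _] : exists r : F, r \in F by apply/card_gt0P; case: F_conn.
(* With any star centre [r], the blue copy lies among the other [#|F| - 1] vertices. *)
have lt_nmF : n * m < #|F|.
  have := arrows_non_isolated (u := r) (A := [set~ r]) m_gt1 F_arr.
  rewrite cardsC1 => le_nmF.
  have := le_nmF (fun x z _ xr _ => etrans (in_setC1 _ _) xr).
  nia.
(* Growth stops one vertex short: as [#|F| >= 2], the size [#|F|.-2.+1] is [#|F| - 1]. *)
have [S [card_S le_S]] : exists S : {set F}, #|S| = #|F|.-2.+1 /\ #|F|.-2 <= #|inner_edges S|.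
  by apply: connected_growth => //; lia.
have F_ge3 : 2 < #|F| by nia.
have [||u [y [uS yS uy]]] := connected_boundary (S := S) F_conn.
- by rewrite -card_gt0 card_S.
- by apply: contraTneq F_ge3 => ST; rewrite ST cardsT in card_S; lia.
have SyT : y |: S = setT.
  by apply/eqP; rewrite eqEcard subsetT cardsU1 yS card_S cardsT; lia.
have count (E : {set {set F}}) :
    {in E, forall e, e \in edges F /\ y \in e} -> #|F|.-2 + #|E| <= gsize F.
  move=> EP; apply: leq_trans (leq_add le_S (leqnn _)) _.
  apply: leq_trans (inner_edges_setU1 yS _) _.
    by move=> e /EP[]; rewrite SyT subsetT.
  by apply/subset_leq_card/subsetP=> e; rewrite inE => /andP[].
(* A second neighbour [z] gives [y] two edges, for a total of at least [#|F|]. *)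
case: (pickP [pred z | adj y z && (z != u)]) => [z /andP[yz zu] | no_z].
  have /count : {in [set [set y; u]; [set y; z]], forall e, e \in edges F /\ y \in e}.
    by move=> _ /set2P[]->; rewrite set21 mem_edges // adj_sym.
  rewrite cards2; suff -> : [set y; u] != [set y; z] by lia.
  apply/eqP=> /setP/(_ z); rewrite !inE eqxx orbT (negPf zu) orbF => /eqP zy.
  by rewrite zy adj_irrefl in yz.
have /count : {in [set [set y; u]], forall e, e \in edges F /\ y \in e}.
  by move=> _ /set1P->; rewrite set21 mem_edges // adj_sym.
(* Here [u] is the only neighbour of [y], so an edge avoiding [u] also avoids [y], and there are
   [n * m] vertices besides these two. *)
have := arrows_non_isolated (u := u) (A := ~: [set u; y]) m_gt1 F_arr.
have := cardsC [set u; y]; rewrite cards1 cards2.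
have -> : u != y by apply: contraTneq uS => ->.
move=> card_A le_nmA; suff: n * m <= #|~: [set u; y]| by lia.
apply: le_nmA => x z xz xu zu; rewrite !inE negb_or xu.
by apply: contraTneq xz => ->; have := no_z z; rewrite /= zu andbT => ->.
Qed.

(** * The cycle on [q.+1] vertices *)

Section Cycle.
Variable q : nat.

(** The condition [i != j] rules out a loop at [q = 0], where [ordS] fixes the only vertex. *)
Definition cycle_adj : rel 'I_q.+1 :=
  fun i j => (i != j) && ((ordS i == j) || (ordS j == i)).

Lemma cycle_adj_sym : symmetric cycle_adj.
Proof. by move=> i j; rewrite /cycle_adj eq_sym orbC. Qed.

Lemma cycle_adj_irrefl : irreflexive cycle_adj.
Proof. by move=> i; rewrite /cycle_adj eqxx. Qed.

Definition cycle_graph : sgraph := SGraph cycle_adj_sym cycle_adj_irrefl.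

Lemma val_ordS (i : 'I_q.+1) : ordS i = (if i == q :> nat then 0 else i.+1) :> nat.
Proof.
rewrite /=; case: eqP => [-> | ]; first by rewrite modnn.
by have := ltn_ord i => lt_iq /eqP neq_iq; rewrite modn_small //; lia.
Qed.

Lemma val_iter_ordS k (i : 'I_q.+1) : iter k (@ordS _) i = (i + k) %% q.+1 :> nat.
Proof.
elim: k => [|k IHk]; first by rewrite addn0 modn_small.
by rewrite iterS /= IHk -addn1 modnDml addn1 addnS.
Qed.

Lemma iter_ordS_inj (i : 'I_q.+1) k l :
  k <= q -> l <= q -> iter k (@ordS _) i = iter l (@ordS _) i -> k = l.
Proof.
move=> le_kq le_lq /(congr1 val); rewrite /= !val_iter_ordS => /eqP.
by rewrite eqn_modDl !modn_small // => /eqP.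
Qed.

Lemma cycle_adj_ordS (i : 'I_q.+1) : 0 < q -> @adj cycle_graph i (ordS i).
Proof.
move=> q_gt0; rewrite /= /cycle_adj eqxx andbT -val_eqE; have := val_ordS i.
by case: ifP => /= cond ->; lia.
Qed.

Lemma cycle_connected : 0 < q -> connected cycle_graph.
Proof.
move=> q_gt0; split=> [|x y]; first by rewrite card_ord.
(* Going forward from [x] through 0 to [y] needs no comparison of [x] with [y]. *)
have -> : y = iter (y + (q.+1 - x)) (@ordS _) x.
  apply: val_inj; rewrite /= val_iter_ordS.
  have -> : x + (y + (q.+1 - x)) = y + q.+1 by have := ltn_ord x; lia.
  by rewrite modnDr modn_small.
elim: (_ + _) => [|k IHk]; first exact: connect0.
by apply: connect_trans IHk (connect1 _); apply: cycle_adj_ordS.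
Qed.

Lemma cycle_edgeP (x y : cycle_graph) :
  adj x y -> exists2 i : 'I_q.+1, [set x; y] = [set i; ordS i]
    & [/\ x = i & y = ordS i] \/ [/\ x = ordS i & y = i].
Proof.
case/andP=> _ /orP[] /eqP <-; first by exists x; auto.
by exists y; [rewrite setUC | auto].
Qed.

(** Edges are indexed by their first endpoint. Two indices of the same edge would be successors of
    each other, which three or more vertices exclude. *)
Lemma cycle_size : 1 < q -> gsize cycle_graph = q.+1.
Proof.
move=> q_gt1; have edge_inj : injective (fun i : 'I_q.+1 => [set i; ordS i]).
  move=> i j eq_ij; apply: val_inj => /=.
  have := set21 i (ordS i); rewrite eq_ij => /set2P[-> // | iSj].
  have := set21 j (ordS j); rewrite -eq_ij => /set2P[-> // | jSi].
  have := val_ordS i; have := val_ordS j; rewrite -iSj -jSi.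
  by do 2 case: ifP; lia.
rewrite /gsize -[RHS](card_ord q.+1) -cardsT -(card_imset _ edge_inj).
apply: eq_card => e; apply/imsetP/imsetP => [[[x y]] | [i _ ->]].
  by rewrite inE /= => /cycle_edgeP[i -> _] ->; exists i.
by exists (i, ordS i) => //; rewrite inE; apply: cycle_adj_ordS; lia.
Qed.

(** [R] selects edges [{i, ordS i}] by their index [i]. Pairwise intersecting edges of a cycle share
    a vertex [v], since [2 < q] excludes the triangle. *)
Lemma cycle_disjoint_edges (R : pred 'I_q.+1) : 2 < q ->
  (exists i j, [/\ R i, R j & [&& i != j, i != ordS j & ordS i != j]]) \/
  (exists v, forall i, R i -> i = v \/ ordS i = v).
Proof.
move=> q_gt2.
case: (pickP [pred p : 'I_q.+1 * 'I_q.+1 | [&& R p.1, R p.2, p.1 != p.2,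
    p.1 != ordS p.2 & ordS p.1 != p.2]]).
  by move=> [i j] /and3P[Ri Rj ij]; left; exists i, j.
move=> meet; right.
have near i j : R i -> R j -> [\/ i = j, i = ordS j | ordS i = j].
  move=> Ri Rj; have := meet (i, j); rewrite /= Ri Rj /= => /negbT.
  rewrite !negb_and !negbK.
  by case/or3P=> /eqP; [constructor 1 | constructor 2 | constructor 3].
case: (pickP R) => [i Ri | noR]; last by exists ord0 => i; rewrite noR.
have [RSi | nRSi] := boolP (R (ordS i)).
  exists (ordS i) => j Rj; case: (near i j Ri Rj) => [-> | iSj | ->]; auto.
  (* If [j] precedes [i], the edges indexed by [j] and [ordS i] are disjoint on four or more
     vertices, against [near]. *)
  have := near _ _ RSi Rj; have := val_ordS i; have := val_ordS j.
  have := val_ordS (ordS i); rewrite -iSj.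
  have [lt_i lt_j] := (ltn_ord i, ltn_ord j); move=> e1 e2 e3.
  by case=> /(congr1 val) /= e4; move: e1 e2 e3; rewrite /= in e4 *;
     do 3 case: ifP; lia.
exists i => j Rj; case: (near i j Ri Rj) => [-> | -> | iSj]; auto.
by rewrite iSj Rj in nRSi.
Qed.

End Cycle.

Lemma cycle_arrows n m : 3 <= n * m ->
  arrows (cycle_graph (n * m)) (copies 2 (complete_graph 2))
    (copies n (path_graph m)).
Proof.
set q := n * m => q_gt2 c.
pose R (i : 'I_q.+1) := is_colour (c [set i; ordS i]) Red.
have adjS (i : 'I_q.+1) : @adj (cycle_graph q) i (ordS i).
  by apply: cycle_adj_ordS; lia.
case: (cycle_disjoint_edges R q_gt2) => [[i [j [Ri Rj ij]]] | [v Rv]].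
  left; case/and3P: ij => ij iSj Sij.
  apply: (@contains_matching (colour_class c Red) i (ordS i) j (ordS j)).
  - by rewrite /= /colour_adj adjS.
  - by rewrite /= /colour_adj adjS.
  have /andP[iSi _] := adjS i; have /andP[jSj _] := adjS j.
  rewrite /= !inE !negb_or iSi jSj ij iSj Sij.
  by rewrite (inj_eq (can_inj (@ordSK _))) ij.
right.
(* The paths are consecutive blocks of [m] vertices; the extra step starts them just after [v],
   which they never meet. *)
pose f (p : 'I_n * 'I_m) : 'I_q.+1 := iter (p.1 * m + p.2).+1 (@ordS _) v.
have ltq (p : 'I_n * 'I_m) : p.1 * m + p.2 < q.
  by case: p => a b /=; have := ltn_ord a; have := ltn_ord b; rewrite /q; nia.
(* A red edge would touch [v], but both ends lie between 1 and [q] steps past [v]. The bound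
   excludes the last vertex, whose successor is [v]. *)
have bluestep (p : 'I_n * 'I_m) : (p.1 * m + p.2).+1 < q ->
    is_colour (c [set f p; ordS (f p)]) Blue.
  move=> lt_pq; have := Rv (f p); rewrite /R; case: (c _) => //= /(_ isT) vP.
  have no_return k : k < q -> iter k.+1 (@ordS _) v != v.
    by move=> lt_kq; apply/eqP => /(@iter_ordS_inj q v k.+1 0 lt_kq isT).
  case: vP => /eqP; apply: contraTT => _; first by apply: no_return; lia.
  exact: (no_return (p.1 * m + p.2).+1).
exists f; split.
  move=> [a b] [a' b'] /iter_ordS_inj.
  have [lt_abq lt_abq'] := (ltq (a, b), ltq (a', b')).
  move=> /(_ lt_abq lt_abq') [] /= e.
  have lt_b := ltn_ord b; have lt_b' := ltn_ord b'.
  (* Quotient and remainder by [m] recover the copy and the position in it. *)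
  have := congr1 (divn^~ m) e; have := congr1 (modn^~ m) e => /=.
  rewrite !modnMDl !modn_small // !divnMDl ?divn_small ?addn0; try lia.
  by move=> /val_inj -> /val_inj ->.
have adjf (a : 'I_n) (b b' : 'I_m) : b.+1 = b' ->
    colour_adj (F := cycle_graph q) c Blue (f (a, b)) (f (a, b')).
  move=> bb'; have eq_f : f (a, b') = ordS (f (a, b)) by rewrite /f /= -bb' addnS.
  rewrite /colour_adj eq_f adjS bluestep //=.
  by have := ltq (a, b'); rewrite /= -bb' addnS.
move=> [a b] [a' b'] /andP[/= /eqP <-] /orP[] /eqP bb'; first exact: adjf.
by rewrite /= colour_adj_sym; apply: adjf.
Qed.

Theorem theorem3p2 : forall (n m : nat), 1 <= n -> 3 <= m ->
  is_conn_size_ramsey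
    (copies 2 (complete_graph 2)) (copies n (path_graph m)) (n * m + 1).
Proof.
move=> n m n_gt0 m_ge3; have q_gt2 : 3 <= n * m by nia.
split=> [|F F_conn F_arr].
  exists (cycle_graph (n * m)); rewrite addn1; split.
  - by apply: cycle_connected; lia.
  - exact: cycle_arrows.
  - by apply: cycle_size; lia.
by rewrite addn1; apply: ramsey_lower_bound => //; lia.
Qed.
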